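(* Let $\dot z^{(1)}=F^{(1)}(z^{(1)})$ and $\dot z^{(2)}=F^{(2)}(z^{(2)})$ be two dynamical systems on $\mathbb{R}^d$ with flows $S^{(1)}_t$, $S^{(2)}_t$ that are topologically orbit equivalent through a homeomorphism $h:\mathbb{R}^d\to\mathbb{R}^d$, $z^{(2)}=h(z^{(1)})$. Let $\Psi=(\psi_1,\dots,\psi_N)$ be a dictionary of observables with span $U$, and suppose: (A1) $\mathcal{K}_{F^{(i)}}U\subseteq U$ for $i=1,2$; (A2) $\mathcal{C}_hU\subseteq U$; (A3) $\psi_1,\dots,\psi_N$ are linearly independent. Let $K^{(i)}\in\mathbb{C}^{N\times N}$ be the matrix of the restriction of $\mathcal{K}_{F^{(i)}}$ to $U$, and suppose that for each $i=1,2$ the matrix $K^{(i)}$ is diagonalizable with distinct eigenvalues. Then: (i) $K^{(1)}$ and $K^{(2)}$ are similar. Let $V^{(1)},V^{(2)}\in\mathbb{C}^{N\times N}$ be matrices whose rows are left eigenvectors of $K^{(1)}$, $K^{(2)}$ respectively, ordered with matched eigenvalues (for each $j$, the $j$-th row of $V^{(1)}$ and the $j$-th row of $V^{(2)}$ belong to the same eigenvalue). Assume further: (A4) the coordinate projections $P_k(z)=z_k$, $k=1,\dots,d$, belong to $U$, i.e. there is $B\in\mathbb{R}^{d\times N}$ such that $P=(P_1,\dots,P_d)^T=B\Psi$; (A5) a pair of matching values $z^{(1)}_0,\ z^{(2)}_0=h(z^{(1)}_0)\in\mathbb{R}^d$ is given such that $\sum_{k=1}^N V^{(1)}_{jk}\psi_k(z^{(1)}_0)\neq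 0$ for all $j=1,\dots,N$. Then: (ii) for all $z\in\mathbb{R}^d$, $$h(z)=B\left[V^{(2)}\right]^{-1}D\,V^{(1)}\Psi(z),$$ where $D$ is the diagonal matrix with entries $$D_{jj}=\frac{\sum_{k=1}^N V^{(2)}_{jk}\psi_k(z^{(2)}_0)}{\sum_{k=1}^N V^{(1)}_{jk}\psi_k(z^{(1)}_0)},\qquad j=1,\dots,N.$$
   Context: Topological orbit equivalence through $h$ means that $h$ is a homeomorphism with $S^{(2)}_t(h(z))=h(S^{(1)}_t(z))$ for all $z$ and all $t$. The observables $\psi_j:\mathbb{R}^d\to\mathbb{C}$ are (continuously differentiable) functions, $\Psi(z)=(\psi_1(z),\dots,\psi_N(z))^T$ is regarded as a column vector, and $U=\mathrm{Span}(\Psi)=\{\sum_{j=1}^N a_j\psi_j : a\in\mathbb{C}^N\}$. $\mathcal{K}_{F^{(i)}}$ denotes the infinitesimal generator of the Koopman operators $g\mapsto g\circ S^{(i)}_t$ of the $i$-th system, $$\mathcal{K}_{F^{(i)}}\phi=\lim_{t\to0}\frac{\phi\circ S^{(i)}_t-\phi}{t}=F^{(i)}\cdot\nabla\phi ,$$ and $\mathcal{C}_h$ is the composition operator $\mathcal{C}_h\phi=\phi\circ h$. Under (A1) and (A3), the matrix $K^{(i)}\in\mathbb{C}^{N\times N}$ is defined by the requirement that $\mathcal{K}_{F^{(i)}}\phi=a^TK^{(i)}\Psi$ for every $\phi=a^T\Psi=\sum_{j}a_j\psi_j\in U$. A left eigenvector of $K$ with eigenvalue $\lambda$ is a nonzero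 $v\in\mathbb{C}^N$ with $v^TK=\lambda v^T$. *)

(* Defs.v *)
From HB Require Import structures.
From mathcomp Require Import all_boot all_order all_algebra.
From mathcomp Require Import all_classical all_reals all_analysis.
From mathcomp Require Import complex.

Set Implicit Arguments.
Unset Strict Implicit.
Unset Printing Implicit Defensive.

Import Order.TTheory GRing.Theory Num.Theory.
Import numFieldNormedType.Exports.

Local Open Scope classical_set_scope.
Local Open Scope ring_scope.
Local Open Scope complex_scope.

Definition is_flow (R : realType) (d : nat) (F : 'cV[R]_d -> 'cV[R]_d)
    (S : R -> 'cV[R]_d -> 'cV[R]_d) : Prop :=
  [/\ forall z, S 0 z = z,
      forall s t z, S (s + t) z = S s (S t z) &
      forall (t : R) z, is_derive t 1 (fun s : R => S s z) (F (S t z))].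

Definition homeomorphism (T T' : topologicalType) (h : T -> T') : Prop :=
  continuous h /\
  exists g : T' -> T, [/\ continuous g, cancel h g & cancel g h].

(* No time change is allowed along the orbits. *)
Definition orbit_equivalent (R : realType) (d : nat)
    (S1 S2 : R -> 'cV[R]_d -> 'cV[R]_d) (h : 'cV[R]_d -> 'cV[R]_d) : Prop :=
  homeomorphism h /\ forall t z, S2 t (h z) = h (S1 t z).

Definition C1_real (R : realType) (d : nat) (f : 'cV[R]_d -> R) : Prop :=
  (forall z, differentiable f z) /\
  forall v : 'cV[R]_d, continuous (fun z => 'd f z v).

(* Real continuous differentiability: R[i] carries no normed space structure
   over R in the library, so it is expressed on real and imaginary parts. *)
Definition C1_complex (R : realType) (d : nat) (phi : 'cV[R]_d -> R[i]) :
    Prop :=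
  C1_real (fun z => complex.Re (phi z)) /\ C1_real (fun z => complex.Im (phi z)).

(* The cast to [numFieldType] selects the topology of the modulus on R[i].
   The limit is pointwise in [z] and equals (F . grad phi)(z) when [phi] is
   continuously differentiable and [S] is the flow of [F]; as usual, [lim] has
   a meaningless value if the limit does not exist. *)
Definition koopman_generator (R : realType) (d : nat)
    (S : R -> 'cV[R]_d -> 'cV[R]_d) (phi : 'cV[R]_d -> R[i]) :
    'cV[R]_d -> R[i] :=
  fun z => lim (((phi (S t z) - phi z) / t%:C : (R[i] : numFieldType))
                  @[t --> (0 : R)^']).

Definition composition_op (R : realType) (d : nat) (h : 'cV[R]_d -> 'cV[R]_d)
    (phi : 'cV[R]_d -> R[i]) : 'cV[R]_d -> R[i] := phi \o h.

Definition dict_col (R : realType) (d N : nat) (psi : 'I_N -> 'cV[R]_d -> R[i])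
    (z : 'cV[R]_d) : 'cV[R[i]]_N := \col_j psi j z.

Definition dict_comb (R : realType) (d N : nat)
    (psi : 'I_N -> 'cV[R]_d -> R[i]) (a : 'rV[R[i]]_N) : 'cV[R]_d -> R[i] :=
  fun z => \sum_j a 0 j * psi j z.

Definition dict_span (R : realType) (d N : nat)
    (psi : 'I_N -> 'cV[R]_d -> R[i]) : set ('cV[R]_d -> R[i]) :=
  range (dict_comb psi).

Definition dict_free (R : realType) (d N : nat)
    (psi : 'I_N -> 'cV[R]_d -> R[i]) : Prop :=
  forall a : 'rV[R[i]]_N, (forall z, dict_comb psi a z = 0) -> a = 0.

Definition is_koopman_matrix (R : realType) (d N : nat)
    (S : R -> 'cV[R]_d -> 'cV[R]_d) (psi : 'I_N -> 'cV[R]_d -> R[i])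
    (K : 'M[R[i]]_N) : Prop :=
  forall a : 'rV[R[i]]_N,
    koopman_generator S (dict_comb psi a) = dict_comb psi (a *m K).

Definition distinct_eigenvalues (F : fieldType) (N : nat) (K : 'M[F]_N) :
    Prop :=
  exists s : N.-tuple F, uniq s /\ all (eigenvalue K) s.

Definition left_eigenvector (F : fieldType) (N : nat) (K : 'M[F]_N)
    (lam : F) (v : 'rV[F]_N) : Prop :=
  v != 0 /\ v *m K = lam *: v.

(* Main.v *)
Require Import Defs.
From HB Require Import structures.
From mathcomp Require Import all_boot all_order all_algebra.
From mathcomp Require Import all_classical all_reals all_analysis.
From mathcomp Require Import complex.

(** The orbit equivalence intertwines the two Koopman generators:
    since [h (S1 t z) = S2 t (h z)], the difference quotients of [phi \o h]
    along [S1] at [z] are those of [phi] along [S2] at [h z], so composing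
    with [h] carries the second generator to the first
    ([koopman_generator_comp]).

    On the invariant span the composition with [h] is a matrix [C], given by
    [dict_col psi (h z) = C *m dict_col psi z].  It is invertible because [h]
    is onto and the dictionary is free ([dict_comp_unitmx]), and comparing
    coordinates turns the intertwining into [C *m K1 = K2 *m C]
    ([koopman_matrix_intertwine]).  This is the similarity.

    Consequently [V2 *m C] has rows that are left eigenvectors of [K1], with
    the same eigenvalues as the rows of [V1].  The eigenvalues being distinct,
    [V1] is a basis in which each eigenvalue occurs once
    ([eigenrows_unitmx]), so that [V2 *m C = E *m V1] with [E] diagonal
    ([eigenrows_proportional]).  Applied to [dict_col psi z1], this identity
    reads [V2 *m dict_col psi (h z1) = E *m (V1 *m dict_col psi z1)], which
    identifies [E] with the matrix [D] of quotients.  Hence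
    [C = invmx V2 *m D *m V1], and, up to the embedding of [R] in [R[i]],
    [h z = B *m dict_col psi (h z) = B *m C *m dict_col psi z]. *)

Set Implicit Arguments.
Unset Strict Implicit.
Unset Printing Implicit Defensive.

Import Order.TTheory GRing.Theory Num.Theory.
Import numFieldNormedType.Exports.

Local Open Scope classical_set_scope.
Local Open Scope ring_scope.
Local Open Scope complex_scope.

Lemma eigenrowsE (F : fieldType) (N : nat) (K V : 'M[F]_N) (lam : 'I_N -> F) :
  (forall j, left_eigenvector K (lam j) (row j V)) ->
  V *m K = diag_mx (\row_j lam j) *m V.
Proof.
move=> eigV; apply/row_matrixP => j.
by rewrite !row_mul (eigV j).2 row_diag_mx mxE -scalemxAl -rowE.
Qed.

(** Eigenspaces of distinct eigenvalues are in direct sum. *)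
Lemma eigenrows_unitmx (F : fieldType) (N : nat) (K V : 'M[F]_N)
    (lam : 'I_N -> F) :
  injective lam ->
  (forall j, left_eigenvector K (lam j) (row j V)) -> V \in unitmx.
Proof.
move=> lam_inj eigV; rewrite -row_free_unit; apply: inj_row_free => a aV0.
have inE_ j : (a 0 j *: row j V <= eigenspace K (lam j))%MS.
  by apply/scalemx_sub/eigenspaceP; rewrite (eigV j).2.
have /mxdirect_sumsP dirE : mxdirect (\sum_(i | true) eigenspace K (lam i)).
  by apply: mxdirect_sum_eigenspace => i j _ _ /lam_inj.
apply/rowP => i; rewrite mxE.
have /eqP : a 0 i *: row i V == 0.
  rewrite -submx0 -(dirE i isT) sub_capmx inE_ /=.
  move: aV0; rewrite mulmx_sum_row (bigD1 i) //= => /eqP.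
  rewrite addr_eq0 => /eqP ->; rewrite eqmx_opp.
  by apply: summx_sub_sums => j _; exact: inE_.
by move/eqP; rewrite scaler_eq0 (negPf (eigV i).1) orbF => /eqP.
Qed.

(** In the basis [V], right multiplication by [K] is diagonal with distinct
    entries, and only diagonal matrices commute with such a matrix. *)
Lemma eigenrows_proportional (F : fieldType) (N : nat) (K V W : 'M[F]_N)
    (lam : 'I_N -> F) :
  injective lam -> V \in unitmx ->
  V *m K = diag_mx (\row_j lam j) *m V ->
  W *m K = diag_mx (\row_j lam j) *m W ->
  exists e, W = diag_mx e *m V.
Proof.
set L := diag_mx _ => lam_inj Vu VK WK.
have comm : W *m invmx V *m L = L *m (W *m invmx V).
  have LE : L = V *m K *m invmx V by rewrite VK mulmxK.
  by rewrite {1}LE !mulmxA mulmxKV // WK.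
have diagM : forall i j : 'I_N, i != j :> nat ->
    (W *m invmx V) i j = 0.
  move=> i j neq_ij; move/matrixP/(_ i j): comm.
  rewrite mul_mx_diag mul_diag_mx !mxE mulrC => /eqP.
  rewrite -subr_eq0 -mulrBl mulf_eq0 subr_eq0 (inj_eq lam_inj).
  by rewrite eq_sym (negPf neq_ij : (i == j) = false) => /eqP.
have /is_diag_mxP/diag_mxP [e eE] := diagM.
by exists e; rewrite -eE mulmxKV.
Qed.

(** The two generators are limits of the same function of [t], so no
    convergence has to be established. *)
Lemma koopman_generator_comp (R : realType) (d : nat)
    (S1 S2 : R -> 'cV[R]_d -> 'cV[R]_d) (h : 'cV[R]_d -> 'cV[R]_d)
    (phi : 'cV[R]_d -> R[i]) :
  (forall t z, S2 t (h z) = h (S1 t z)) ->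
  koopman_generator S1 (phi \o h) = koopman_generator S2 phi \o h.
Proof.
move=> S12; apply/funext => z; rewrite /koopman_generator /=.
by under eq_fun do rewrite -S12.
Qed.

Section Dictionary.
Variables (R : realType) (d N : nat) (psi : 'I_N -> 'cV[R]_d -> R[i]).

Lemma dict_combE a z : dict_comb psi a z = (a *m dict_col psi z) 0 0.
Proof. by rewrite mxE; apply: eq_bigr => j _; rewrite mxE. Qed.

Lemma dict_comb_inj a b :
  dict_free psi -> dict_comb psi a =1 dict_comb psi b -> a = b.
Proof.
move=> free eq_ab; apply/eqP; rewrite -subr_eq0; apply/eqP/free => z.
by rewrite dict_combE mulmxBl mxE [X in _ + X]mxE -!dict_combE eq_ab subrr.
Qed.

Lemma dict_comp_matrix (h : 'cV[R]_d -> 'cV[R]_d) :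
  composition_op h @` dict_span psi `<=` dict_span psi ->
  exists C : 'M[R[i]]_N, forall z, dict_col psi (h z) = C *m dict_col psi z.
Proof.
move=> hU.
have row_ex j : exists c : 'rV[R[i]]_N, dict_comb psi c =1 psi j \o h.
  have [|c _ cE] := hU (composition_op h (dict_comb psi (delta_mx 0 j))).
    by exists (dict_comb psi (delta_mx 0 j)) => //; exists (delta_mx 0 j).
  exists c => z; rewrite cE /composition_op /= dict_combE -rowE.
  by rewrite !mxE.
have [c cE] := choice row_ex.
exists (\matrix_j c j) => z; apply/colP => j.
rewrite mxE -[LHS]/((psi j \o h) z) -cE [RHS]mxE.
by apply: eq_bigr => k _; rewrite !mxE.
Qed.

(** A combination of the dictionary killed by composition with [h] vanishes
    on the range of [h], which is the whole space. *)
Lemma dict_comp_unitmx (h g : 'cV[R]_d -> 'cV[R]_d) (C : 'M[R[i]]_N) :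
  cancel g h -> dict_free psi ->
  (forall z, dict_col psi (h z) = C *m dict_col psi z) -> C \in unitmx.
Proof.
move=> gK free CE; rewrite -row_free_unit; apply: inj_row_free => a aC0.
by apply: free => z; rewrite dict_combE -(gK z) CE mulmxA aC0 mul0mx mxE.
Qed.

Lemma koopman_matrix_intertwine (S1 S2 : R -> 'cV[R]_d -> 'cV[R]_d)
    (h : 'cV[R]_d -> 'cV[R]_d) (K1 K2 C : 'M[R[i]]_N) :
  (forall t z, S2 t (h z) = h (S1 t z)) -> dict_free psi ->
  is_koopman_matrix S1 psi K1 -> is_koopman_matrix S2 psi K2 ->
  (forall z, dict_col psi (h z) = C *m dict_col psi z) ->
  C *m K1 = K2 *m C.
Proof.
move=> S12 free K1E K2E CE.
have comb_h a : dict_comb psi a \o h = dict_comb psi (a *m C).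
  by apply/funext => z; rewrite /= !dict_combE CE mulmxA.
apply/row_matrixP => j; rewrite !rowE; apply: dict_comb_inj => // z.
rewrite !mulmxA -K1E -!comb_h -K2E.
by rewrite (koopman_generator_comp _ S12).
Qed.

End Dictionary.

Theorem theorem3 (R : realType) (d N : nat)
    (F1 F2 : 'cV[R]_d -> 'cV[R]_d)
    (S1 S2 : R -> 'cV[R]_d -> 'cV[R]_d)
    (h : 'cV[R]_d -> 'cV[R]_d)
    (psi : 'I_N -> 'cV[R]_d -> R[i])
    (K1 K2 : 'M[R[i]]_N)
    (flow1 : is_flow F1 S1) (flow2 : is_flow F2 S2)
    (S12 : orbit_equivalent S1 S2 h)
    (psiC1 : forall j, C1_complex (psi j))
    (A1_1 : koopman_generator S1 @` dict_span psi `<=` dict_span psi)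
    (A1_2 : koopman_generator S2 @` dict_span psi `<=` dict_span psi)
    (A2 : composition_op h @` dict_span psi `<=` dict_span psi)
    (A3 : dict_free psi)
    (K1E : is_koopman_matrix S1 psi K1) (K2E : is_koopman_matrix S2 psi K2)
    (K1diag : diagonalizable K1) (K1dist : distinct_eigenvalues K1)
    (K2diag : diagonalizable K2) (K2dist : distinct_eigenvalues K2) :
  similar_in unitmx K1 K2 /\
  forall (V1 V2 : 'M[R[i]]_N) (lam : 'I_N -> R[i]) (B : 'M[R]_(d, N))
      (z1 z2 : 'cV[R]_d),
    injective lam ->
    (forall j, left_eigenvector K1 (lam j) (row j V1)) ->
    (forall j, left_eigenvector K2 (lam j) (row j V2)) ->
    (forall z, map_mx (real_complex R) z =
               map_mx (real_complex R) B *m dict_col psi z) ->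
    z2 = h z1 ->
    (forall j, \sum_k V1 j k * psi k z1 != 0) ->
    let D := diag_mx (\row_j ((\sum_k V2 j k * psi k z2) /
                              (\sum_k V1 j k * psi k z1))) in
    V2 \in unitmx /\
    forall z, map_mx (real_complex R) (h z) =
              map_mx (real_complex R) B *m invmx V2 *m D *m V1
                *m dict_col psi z.
Proof.
have [[_ [g [_ _ gK]]] S12h] := S12.
have [C CE] := dict_comp_matrix A2.
have Cu := dict_comp_unitmx gK A3 CE.
have CK := koopman_matrix_intertwine S12h A3 K1E K2E CE.
split; first by exists C => //; apply/simmxP.
move=> V1 V2 lam B z1 z2 lam_inj eig1 eig2 BE z2E nz1 D.
have V1u := eigenrows_unitmx lam_inj eig1.
have V2u := eigenrows_unitmx lam_inj eig2.
split=> // z.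
have [|e eE] := eigenrows_proportional (W := V2 *m C) lam_inj V1u
  (eigenrowsE eig1).
  by rewrite -mulmxA CK !mulmxA (eigenrowsE eig2).
have sumE (V : 'M[R[i]]_N) j y :
    \sum_k V j k * psi k y = (V *m dict_col psi y) j 0.
  by rewrite mxE; apply: eq_bigr => k _; rewrite mxE.
have DE : D = diag_mx e.
  (* The entries of [e] are read off from [eE] at the single point [z1]. *)
  congr diag_mx; apply/rowP => j; rewrite mxE.
  apply: (canLR (mulfK (nz1 j))).
  by rewrite !sumE z2E CE mulmxA eE -mulmxA mul_diag_mx mxE.
by rewrite BE CE DE -!mulmxA (mulmxA (diag_mx e)) -eE -mulmxA mulKmx.
Qed.
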